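(* Let $a,b,c,d,e,f\in\mathbb{C}$, $f_1=ax^2+bxy+cy^2$, $f_2=dx^2+exy+fy^2$, and suppose $p=f_1^3+f_2^3$ is even (i.e. $p(x,-y)=p(x,y)$) and $p=f_3^3+f_4^3$ for even binary quadratic forms $f_3,f_4$, where $f_1,f_2,f_3,f_4$ are pairwise non-proportional. Suppose $(b,e)\neq(0,0)$ and $(d,e,f)\neq\omega^k(a,-b,c)$ for $k=0,1,2$. Then some flip of the identity $f_1^3+f_2^3=f_3^3+f_4^3$ is of Type$(T)$ for some $T\in\mathbb{C}$, and $p$ has a third representation $p=g_1^3+g_2^3$ with $g_1,g_2$ binary quadratic forms and $\{g_1^3,g_2^3\}$ different from both $\{f_1^3,f_2^3\}$ and $\{f_3^3,f_4^3\}$.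
   Context: $\omega=e^{2\pi i/3}$. A binary quadratic form is even if it has no $xy$ term. The flips of an identity $g_1^3+g_2^3=g_3^3+g_4^3$ are $g_1^3-g_3^3=-g_2^3+g_4^3$ and $g_1^3-g_4^3=-g_2^3+g_3^3$. An identity $h_1^3+h_2^3=h_3^3+h_4^3$ among pairwise non-proportional binary quadratic forms is of Type$(T)$ if $h_1+h_2=T(h_3+h_4)$ (the flip being written in this form with $h_1,h_2$ on the left and $h_3,h_4$ on the right).
   Formalization: ''Some flip is of Type(T)'' is read up to cube roots of unity: each form in the flip may be replaced by another with the same cube, since the relation for the given f_3, f_4 themselves fails, for instance, when f_3 is replaced by ωf_3. *)

(* Defs.v *)
(* The field of complex numbers is R[i] for R : realType. *)
From mathcomp Require Import all_boot all_order all_algebra.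
From mathcomp Require Import complex reals.
From mathcomp Require Import mpoly.
(* trigo is not Imported: its notations clash with those of mpoly. *)
From mathcomp Require trigo.

Set Implicit Arguments.
Unset Strict Implicit.
Unset Printing Implicit Defensive.

Import Order.TTheory GRing.Theory Num.Theory.
Local Open Scope ring_scope.
Local Open Scope complex_scope.

(* exp(2 pi i / 3), through Euler's formula. *)
Definition omega (R : realType) : R[i] :=
  let theta := 2 * @trigo.pi R / 3 in trigo.cos theta +i* trigo.sin theta.

Section Forms.
Variable C : fieldType.
Implicit Types (f g h p q : {mpoly C[2]}) (T : C).

Definition varx : {mpoly C[2]} := 'X_(@ord0 1).
Definition vary : {mpoly C[2]} := 'X_(@ord_max 1).

Definition qform (a b c : C) : {mpoly C[2]} :=
  a *: varx ^+ 2 + b *: (varx * vary) + c *: vary ^+ 2.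

Definition binary_quadratic f : Prop := exists a b c : C, f = qform a b c.

Definition even_quadratic f : Prop := exists a c : C, f = qform a 0 c.

Definition even_in_y p : Prop := p \mPo [tuple varx; - vary] = p.

(* Linear dependence, so the zero form is proportional to every form. *)
Definition proportional f g : Prop :=
  exists s t : C, (s, t) <> (0, 0) /\ s *: f = t *: g.

Definition pairwise_nonproportional f1 f2 f3 f4 : Prop :=
  [/\ ~ proportional f1 f2, ~ proportional f1 f3 & ~ proportional f1 f4] /\
  [/\ ~ proportional f2 f3, ~ proportional f2 f4 & ~ proportional f3 f4].

(* The identity P1 + P2 = P3 + P4, given by its four terms. *)
Record cubic_identity := CubicIdentity {
  left1 : {mpoly C[2]}; left2 : {mpoly C[2]};
  right1 : {mpoly C[2]}; right2 : {mpoly C[2]} }.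

Definition identity_of_forms g1 g2 g3 g4 : cubic_identity :=
  CubicIdentity (g1 ^+ 3) (g2 ^+ 3) (g3 ^+ 3) (g4 ^+ 3).

(* P1 - P3 = - P2 + P4 and P1 - P4 = - P2 + P3 *)
Definition flip1 (I : cubic_identity) : cubic_identity :=
  CubicIdentity (left1 I) (- right1 I) (- left2 I) (right2 I).
Definition flip2 (I : cubic_identity) : cubic_identity :=
  CubicIdentity (left1 I) (- right2 I) (- left2 I) (right1 I).

(* The identity only involves the cubes of the forms, so it is of Type(T) when
   it can be written as h1^3 + h2^3 = h3^3 + h4^3 with h1 + h2 = T (h3 + h4).
   Each h_i is thus chosen up to a cube root of unity: fixing the choice in
   advance would make Type(T) depend on more than the identity. *)
Definition has_type T (I : cubic_identity) : Prop :=
  exists h1 h2 h3 h4,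
    [/\ I = identity_of_forms h1 h2 h3 h4,
        h1 ^+ 3 + h2 ^+ 3 = h3 ^+ 3 + h4 ^+ 3,
        [/\ binary_quadratic h1, binary_quadratic h2,
            binary_quadratic h3 & binary_quadratic h4],
        pairwise_nonproportional h1 h2 h3 h4 &
        h1 + h2 = T *: (h3 + h4)].

(* Equality of the unordered pairs {p1, p2} and {q1, q2}. *)
Definition same_pair p1 p2 q1 q2 : Prop :=
  (p1 = q1 /\ p2 = q2) \/ (p1 = q2 /\ p2 = q1).

End Forms.

(* Main.v *)
Require Import Defs.
From mathcomp Require Import all_boot all_order all_algebra.
From mathcomp Require Import complex reals.
From mathcomp Require Import mpoly.
From mathcomp Require trigo.
From mathcomp Require Import ring lra.

Import Order.TTheory GRing.Theory Num.Theory.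
Local Open Scope ring_scope.
Local Open Scope complex_scope.

(* Vanishing of the coefficients of x^5 y, x^3 y^3 and x y^5 in f1^3 + f2^3,
   with the excluded configurations removed, forces f1 = (l d, b, - l f) and
   f2 = (d, - l^2 b, f) with b^2 (1 - l^6) = 12 l^2 d f and d f (1 - l^6) <> 0.
   As a binary cubic in x^2 and y^2, p is a sum of two cubes in at most one way
   (up to order and cube roots of unity), and solving for it gives explicit
   even forms F3, F4 with f1 - F4 = l^-2 (F3 - f2), which is Type(l^-2) for a
   flip.  The third representation is f1(x, - y)^3 + f2(x, - y)^3. *)

(** * Coefficients of quadratic forms and of sums of two cubes *)

Section CoefficientsOfForms.
Variable C : numFieldType.
Implicit Types (a b c d e f s t z T : C).

(** Setting [x = 1] keeps all coefficients of a form of known degree, so identities between forms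
    can be compared coefficientwise in one variable. *)
Definition dehom (p : {mpoly C[2]}) : {poly C} :=
  mmap (@polyC C) (fun i : 'I_2 => if i == ord0 then 1 else 'X) p.

Lemma dehom_qform a b c : dehom (qform a b c) = Poly [:: a; b; c].
Proof.
rewrite /dehom /qform !rmorphD /= !mmapZ !(rmorphM, rmorphXn) /=.
rewrite !mmapX !mmap1U /= !cons_poly_def; ring.
Qed.

Lemma qform_inj a b c d e f :
  qform a b c = qform d e f -> [/\ a = d, b = e & c = f].
Proof.
move=> /(congr1 dehom); rewrite !dehom_qform => /polyP E.
by split; [have := E 0%N | have := E 1%N | have := E 2%N]; rewrite !coef_Poly.
Qed.

Lemma scale_qform s a b c : s *: qform a b c = qform (s * a) (s * b) (s * c).
Proof. by rewrite /qform !scalerDr !scalerA. Qed.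

Lemma sub_qform a b c d e f :
  qform a b c - qform d e f = qform (a - d) (b - e) (c - f).
Proof. by rewrite /qform !scalerBl; ring. Qed.

Lemma reflect_qform a b c :
  qform a b c \mPo [tuple varx C; - vary C] = qform a (- b) c.
Proof.
rewrite /qform !comp_mpolyD !comp_mpolyZ.
rewrite !(rmorphM, rmorphXn) /= !comp_mpolyXU /=.
by rewrite mulrNN mulrN scalerN scaleNr !expr2.
Qed.

(** The entry of index [i] is the coefficient of [x^(6-i) y^i]. *)
Definition sum_cubes_coefs a b c d e f : seq C :=
  [:: a ^+ 3 + d ^+ 3;
      3 * (a ^+ 2 * b + d ^+ 2 * e);
      3 * (a ^+ 2 * c + a * b ^+ 2 + (d ^+ 2 * f + d * e ^+ 2));
      b ^+ 3 + 6 * (a * b * c) + (e ^+ 3 + 6 * (d * e * f));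
      3 * (a * c ^+ 2 + b ^+ 2 * c + (d * f ^+ 2 + e ^+ 2 * f));
      3 * (b * c ^+ 2 + e * f ^+ 2);
      c ^+ 3 + f ^+ 3].

Lemma dehom_sum_cubes a b c d e f :
  dehom (qform a b c ^+ 3 + qform d e f ^+ 3)
  = Poly (sum_cubes_coefs a b c d e f).
Proof.
rewrite [LHS]rmorphD !rmorphXn /= -!/(dehom _) !dehom_qform /= !cons_poly_def.
ring.
Qed.

Lemma sum_cubes_coefsP a b c d e f a' b' c' d' e' f' :
  qform a b c ^+ 3 + qform d e f ^+ 3
  = qform a' b' c' ^+ 3 + qform d' e' f' ^+ 3 ->
  sum_cubes_coefs a b c d e f = sum_cubes_coefs a' b' c' d' e' f'.
Proof.
move=> /(congr1 dehom); rewrite !dehom_sum_cubes => /polyP E.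
apply: (@eq_from_nth _ 0) => // i _.
by have := E i; rewrite !coef_Poly.
Qed.

Lemma reflect_sum_cubes a b c d e f :
  even_in_y (qform a b c ^+ 3 + qform d e f ^+ 3) ->
  qform a b c ^+ 3 + qform d e f ^+ 3
  = qform a (- b) c ^+ 3 + qform d (- e) f ^+ 3.
Proof.
by move=> <-; rewrite rmorphD !rmorphXn /= !reflect_qform.
Qed.

(** The reflection [y -> -y] changes the sign of the coefficients of odd index, so they vanish; the
    factor 3 is cancelled in the outer two. *)
Lemma even_sum_cubes a b c d e f :
  even_in_y (qform a b c ^+ 3 + qform d e f ^+ 3) ->
  [/\ a ^+ 2 * b + d ^+ 2 * e = 0,
      b ^+ 3 + 6 * (a * b * c) + (e ^+ 3 + 6 * (d * e * f)) = 0 &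
      b * c ^+ 2 + e * f ^+ 2 = 0].
Proof.
have odd0 (x y : C) : x = y -> y = - x -> x = 0.
  by move=> -> /eqP; rewrite eq_sym eqNr => /eqP.
move=> /reflect_sum_cubes /sum_cubes_coefsP E.
have /= E1 := congr1 (nth 0 ^~ 1%N) E; have /= E3 := congr1 (nth 0 ^~ 3%N) E.
have /= E5 := congr1 (nth 0 ^~ 5%N) E.
split.
- apply: (@mulfI _ 3) => //; first by rewrite pnatr_eq0.
  by rewrite mulr0; apply: odd0 E1 _; ring.
- by apply: odd0 E3 _; ring.
- apply: (@mulfI _ 3) => //; first by rewrite pnatr_eq0.
  by rewrite mulr0; apply: odd0 E5 _; ring.
Qed.

(** Stated over an integral domain so as to serve both for scalars and for polynomials, with [w]
    then a constant polynomial. *)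
Lemma cube_eq_roots (K : idomainType) (x y w : K) :
  w ^+ 2 + w + 1 = 0 -> x ^+ 3 = y ^+ 3 ->
  exists2 k : nat, (k < 3)%N & x = w ^+ k * y.
Proof.
move=> hw /eqP.
have -> : (x ^+ 3 == y ^+ 3) = ((x - y) * ((x - w * y) * (x - w ^+ 2 * y)) == 0).
  rewrite -subr_eq0; congr (_ == 0).
  have -> : x ^+ 3 - y ^+ 3 = (x - y) * (x ^+ 2 + x * y + y ^+ 2) by ring.
  have w2 : w ^+ 2 = - 1 - w by apply/eqP; rewrite -subr_eq0 -hw; apply/eqP; ring.
  ring: w2.
rewrite !mulf_eq0 !subr_eq0 => /or3P[] /eqP->.
- by exists 0%N; rewrite // mul1r.
- by exists 1%N.
- by exists 2%N.
Qed.

End CoefficientsOfForms.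

(** * Proportionality of forms and the type of a flip *)

Section Proportionality.
Variable C : fieldType.
Implicit Types (f g : {mpoly C[2]}) (s t T u v : C).

Lemma proportional_sym f g : proportional f g -> proportional g f.
Proof.
move=> [s [t [nz E]]]; exists t, s; split=> // -[Et Es].
by apply: nz; rewrite Et Es.
Qed.

Lemma proportional_scale s t f g : s != 0 -> t != 0 ->
  proportional (s *: f) (t *: g) -> proportional f g.
Proof.
move=> s0 t0 [x [y [nz E]]]; exists (x * s), (y * t); rewrite -!scalerA.
split=> // -[/eqP]; rewrite mulf_eq0 (negbTE s0) orbF => /eqP Ex /eqP.
by rewrite mulf_eq0 (negbTE t0) orbF => /eqP Ey; apply: nz; rewrite Ex Ey.
Qed.

Lemma cube_root1_neq0 u : u ^+ 3 = 1 -> u != 0.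
Proof. by apply: contra_eq_neq => ->; rewrite expr0n eq_sym oner_eq0. Qed.

Lemma binary_quadratic_scale s f :
  binary_quadratic f -> binary_quadratic (s *: f).
Proof.
move=> [a [b [c ->]]]; exists (s * a), (s * b), (s * c).
by rewrite /qform !scalerDr !scalerA.
Qed.

(** Multiplying a form by a cube root of unity does not change its cube, so the linear relation may
    be checked after rescaling [f3] and [f4] by [u] and [v]. *)
Lemma has_type_flip1 T u v f1 f2 f3 f4 :
  u ^+ 3 = 1 -> v ^+ 3 = 1 ->
  [/\ binary_quadratic f1, binary_quadratic f2,
      binary_quadratic f3 & binary_quadratic f4] ->
  pairwise_nonproportional f1 f2 f3 f4 ->
  f1 ^+ 3 + f2 ^+ 3 = f3 ^+ 3 + f4 ^+ 3 ->
  f1 - u *: f3 = T *: (v *: f4 - f2) ->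
  has_type T (flip1 (identity_of_forms f1 f2 f3 f4)).
Proof.
move=> u1 v1 [q1 q2 q3 q4] [[n12 n13 n14] [n23 n24 n34]] E ET.
have nu : - u != 0 by rewrite oppr_eq0 cube_root1_neq0.
have v0 := cube_root1_neq0 _ v1; have N1 : -1 != 0 :> C by rewrite oppr_eq0 oner_eq0.
have c1 (x : C) (h : {mpoly C[2]}) : x ^+ 3 = 1 -> (x *: h) ^+ 3 = h ^+ 3.
  by move=> x1; rewrite exprZn x1 scale1r.
have cN (h : {mpoly C[2]}) : (- h) ^+ 3 = - h ^+ 3.
  by rewrite exprNn -signr_odd /= expr1 mulN1r.
exists f1, ((- u) *: f3), ((-1) *: f2), (v *: f4); rewrite scaleNr scaleN1r; split.
- by rewrite /flip1 /identity_of_forms /= !cN !c1.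
- have -> : f1 ^+ 3 = f3 ^+ 3 + f4 ^+ 3 - f2 ^+ 3 by rewrite -E addrK.
  by rewrite !cN !c1 //; ring.
- split=> //; [rewrite -scaleNr|rewrite -scaleN1r|]; exact: binary_quadratic_scale.
- rewrite -scaleNr -scaleN1r; split; split.
  + by rewrite -[f1]scale1r => /(proportional_scale _ _ _ _ (oner_neq0 _) nu).
  + by rewrite -[f1]scale1r => /(proportional_scale _ _ _ _ (oner_neq0 _) N1).
  + by rewrite -[f1]scale1r => /(proportional_scale _ _ _ _ (oner_neq0 _) v0).
  + by move/(proportional_scale _ _ _ _ nu N1)/proportional_sym.
  + by move/(proportional_scale _ _ _ _ nu v0).
  + by move/(proportional_scale _ _ _ _ N1 v0).
- by rewrite ET [v *: _ - _]addrC.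
Qed.

End Proportionality.

(** * Uniqueness of a sum of cubes of two independent linear forms *)

Section Uniqueness.
Variable C : fieldType.
Implicit Types (k m n p s t u v z w : C).

(* With [(s, t) = x (k, p) + y (m, n)] and [(u, v) = x' (k, p) + y' (m, n)], the
   hypotheses say [x^3 + x'^3 = y^3 + y'^3 = 1] and
   [x^2 y + x'^2 y' = x y^2 + x' y'^2 = 0]; below [A, B, G, D] are [x, y, x', y']
   multiplied by the determinant. *)
Lemma sum_cubes_linear_forms_unique k p m n s t u v :
  k * n - m * p != 0 ->
  s ^+ 3 + u ^+ 3 = k ^+ 3 + m ^+ 3 ->
  s ^+ 2 * t + u ^+ 2 * v = k ^+ 2 * p + m ^+ 2 * n ->
  s * t ^+ 2 + u * v ^+ 2 = k * p ^+ 2 + m * n ^+ 2 ->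
  t ^+ 3 + v ^+ 3 = p ^+ 3 + n ^+ 3 ->
  exists z w, [/\ z ^+ 3 = 1, w ^+ 3 = 1 &
    [/\ k = z * s, p = z * t, m = w * u & n = w * v] \/
    [/\ k = z * u, p = z * v, m = w * s & n = w * t]].
Proof.
set q := k * n - m * p => q0 E0 E1 E2 E3.
pose A := s * n - t * m; pose B := k * t - p * s.
pose G := u * n - v * m; pose D := k * v - p * u.
(* The next four identities evaluate the common binary cubic and its polarisation at [(n, -m)] and
   [(-p, k)], where [m X + n Y] and [k X + p Y] vanish respectively. *)
have EA : A ^+ 3 + G ^+ 3 = q ^+ 3.
  transitivity ((s ^+ 3 + u ^+ 3) * n ^+ 3 - 3 * (s ^+ 2 * t + u ^+ 2 * v) * n ^+ 2 * m
     + 3 * (s * t ^+ 2 + u * v ^+ 2) * n * m ^+ 2 - (t ^+ 3 + v ^+ 3) * m ^+ 3).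
    by rewrite /A /G; ring.
  by rewrite E0 E1 E2 E3 /q; ring.
have EB : B ^+ 3 + D ^+ 3 = q ^+ 3.
  transitivity ((t ^+ 3 + v ^+ 3) * k ^+ 3 - 3 * (s * t ^+ 2 + u * v ^+ 2) * k ^+ 2 * p
     + 3 * (s ^+ 2 * t + u ^+ 2 * v) * k * p ^+ 2 - (s ^+ 3 + u ^+ 3) * p ^+ 3).
    by rewrite /B /D; ring.
  by rewrite E0 E1 E2 E3 /q; ring.
have EAB : A ^+ 2 * B = - (G ^+ 2 * D).
  apply/eqP; rewrite -addr_eq0; apply/eqP.
  transitivity (- (s ^+ 3 + u ^+ 3) * n ^+ 2 * p
     + (s ^+ 2 * t + u ^+ 2 * v) * (k * n ^+ 2 + 2 * n * m * p)
     - (s * t ^+ 2 + u * v ^+ 2) * (2 * k * n * m + p * m ^+ 2)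
     + (t ^+ 3 + v ^+ 3) * k * m ^+ 2).
    by rewrite /A /B /G /D; ring.
  by rewrite E0 E1 E2 E3 /q; ring.
have EBA : A * B ^+ 2 = - (G * D ^+ 2).
  apply/eqP; rewrite -addr_eq0; apply/eqP.
  transitivity (- (t ^+ 3 + v ^+ 3) * k ^+ 2 * m
     + (s * t ^+ 2 + u * v ^+ 2) * (n * k ^+ 2 + 2 * k * p * m)
     - (s ^+ 2 * t + u ^+ 2 * v) * (2 * n * k * p + m * p ^+ 2)
     + (s ^+ 3 + u ^+ 3) * n * p ^+ 2).
    by rewrite /A /B /G /D; ring.
  by rewrite E0 E1 E2 E3 /q; ring.
(* Were [A B] nonzero, the mixed identities would give [A D = B G], making [(A, B)] and [(G, D)]
   dependent; then [q^3 B = (A^3 + G^3) B = 0]. *)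
have AB0 : A * B == 0.
  apply/negPn/negP => AB0.
  have/eqP : A * B * (A * D - B * G) = 0.
    transitivity (A ^+ 2 * B * D - A * B ^+ 2 * G); first by ring.
    by rewrite EAB EBA; ring.
  rewrite mulf_eq0 (negbTE AB0) subr_eq0 /= => /eqP EAD.
  have : q ^+ 3 * B = 0.
    rewrite -EA; transitivity (A * (A ^+ 2 * B) + G ^+ 2 * (B * G)); first by ring.
    by rewrite EAB -EAD; ring.
  move/eqP; rewrite mulf_eq0 expf_eq0 /= (negbTE q0) /= => /eqP B0.
  by move: AB0; rewrite B0 mulr0 eqxx.
have sA : q * s = A * k + B * m by rewrite /q /A /B; ring.
have tA : q * t = A * p + B * n by rewrite /q /A /B; ring.
have uA : q * u = G * k + D * m by rewrite /q /G /D; ring.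
have vA : q * v = G * p + D * n by rewrite /q /G /D; ring.
have cub (x : C) : x ^+ 3 = q ^+ 3 -> x != 0.
  by apply: contra_eq_neq => ->; rewrite expr0n eq_sym expf_neq0.
have unit (x : C) : x ^+ 3 = q ^+ 3 -> (q / x) ^+ 3 = 1.
  by move=> E; rewrite expr_div_n E divff // expf_neq0.
have scal (x y y' : C) : x ^+ 3 = q ^+ 3 -> q * y = x * y' -> y' = q / x * y.
  by move=> /cub x0 E; rewrite mulrAC E mulrAC mulfV // mul1r.
(* [A = 0] forces [D = 0], which matches the forms in exchanged order; [B = 0] forces [G = 0], which
   matches them in the given order. *)
move: AB0; rewrite mulf_eq0 => /orP[] /eqP Z.
- move: EA EAB EBA sA tA; rewrite Z !(mul0r, expr0n, add0r) /= => EG /esym/eqP.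
  rewrite oppr_eq0 mulf_eq0 expf_eq0 /= (negbTE (cub _ EG)) /= => /eqP D0.
  move: EB uA vA; rewrite D0 expr0n !(mul0r, addr0) => EB uA vA _ sA tA.
  exists (q / G), (q / B); split; rewrite ?unit //; right.
  by split; apply: scal.
- move: EB EBA EAB sA tA; rewrite Z !(expr0n, mulr0, mul0r, add0r, addr0) /= => ED /esym/eqP.
  rewrite oppr_eq0 mulf_eq0 expf_eq0 /= (negbTE (cub _ ED)) orbF => /eqP G0.
  move: EA uA vA; rewrite G0 expr0n !(mul0r, addr0, add0r) => EA uA vA _ sA tA.
  exists (q / A), (q / D); split; rewrite ?unit //; left.
  by split; apply: scal.
Qed.
End Uniqueness.

(** * Solving the equations of the odd coefficients *)

Section Classification.
Variable C : numClosedFieldType.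
Implicit Types (a b c d e f l z : C).

(** If [b = 0] then [e] is nonzero, the first equation gives [d = 0], and the second becomes
    [e^3 = 0]. *)
Lemma even_coefs_neq0 a b c d e f :
  a ^+ 2 * b + d ^+ 2 * e = 0 ->
  b ^+ 3 + 6 * (a * b * c) + (e ^+ 3 + 6 * (d * e * f)) = 0 ->
  b * c ^+ 2 + e * f ^+ 2 = 0 ->
  (b, e) <> (0, 0) -> b != 0.
Proof.
move=> E1 E3 E5 be; apply/eqP => b0.
have e0 : e != 0 by apply/eqP => e0; apply: be; rewrite b0 e0.
move: E1 E3 E5; rewrite b0 !(mulr0, mul0r, add0r, expr0n) /=.
move=> /eqP; rewrite mulf_eq0 (negbTE e0) orbF expf_eq0 /= => /eqP ->.
move=> E3 _; move/eqP: E3; rewrite !(mul0r, mulr0, addr0) expf_eq0 /=.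
by rewrite (negbTE e0).
Qed.

Lemma even_sum_cubes_param a b c d e f :
  a ^+ 2 * b + d ^+ 2 * e = 0 ->
  b ^+ 3 + 6 * (a * b * c) + (e ^+ 3 + 6 * (d * e * f)) = 0 ->
  b * c ^+ 2 + e * f ^+ 2 = 0 ->
  (b, e) <> (0, 0) ->
  ~ proportional (qform a b c) (qform d e f) ->
  (forall z, z ^+ 3 = 1 -> (d, e, f) <> (z * a, z * - b, z * c)) ->
  exists l, [/\ l != 0, (l ^+ 3) ^+ 2 != 1, d != 0 & f != 0] /\
            [/\ a = l * d, c = - (l * f), e = - (l ^+ 2 * b) &
                b ^+ 2 * (1 - (l ^+ 3) ^+ 2) = 12 * l ^+ 2 * d * f].
Proof.
move=> E1 E3 E5 be np nw.
have b0 := even_coefs_neq0 _ _ _ _ _ _ E1 E3 E5 be.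
(* The first equation reads [a^2 = l^2 d^2] once [l^2 = - e / b]; the sign of the square root is
   chosen so that [a = l d]. *)
have [l l2 Ea] : exists2 l, e = - (l ^+ 2 * b) & a = l * d.
  pose l := sqrtC (- (e / b)).
  have l2 : e = - (l ^+ 2 * b) by rewrite sqrtCK; field.
  have : a ^+ 2 = (l * d) ^+ 2.
    apply: (mulIf b0); apply/eqP; rewrite -subr_eq0; apply/eqP; rewrite -E1 l2; ring.
  move/eqP; rewrite eqf_sqr => /orP[] /eqP Ea; first by exists l.
  by exists (- l); rewrite ?sqrrN // mulNr.
have e0 : e != 0.
  apply: (@even_coefs_neq0 d e f a b c); rewrite 1?addrC //.
  by move=> [_ bz]; rewrite bz eqxx in b0.
have l0 : l != 0.
  by apply: contra_neq e0; rewrite l2 => ->; rewrite expr0n mul0r oppr0.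
have : c ^+ 2 = (l * f) ^+ 2.
  apply: (mulIf b0); apply/eqP; rewrite -subr_eq0; apply/eqP; rewrite -E5 l2; ring.
(* The sign [c = l f] is impossible: the middle coefficient becomes [b^3 (1 - l^6)], so [l^3 = 1]
   gives the excluded [f2 = l^2 (a, -b, c)] and [l^3 = -1] gives [f1 = l f2]. *)
move/eqP; rewrite eqf_sqr => /orP[] /eqP Ec.
  have : b ^+ 3 * (1 - (l ^+ 3) ^+ 2) = 0 by rewrite -E3 l2 Ea Ec; ring.
  move/eqP; rewrite mulf_eq0 expf_eq0 /= (negbTE b0) /= subr_eq0 eq_sym sqrf_eq1.
  case/orP=> /eqP l3.
  - case: (nw (l ^+ 2)); first by rewrite exprAC l3 expr1n.
    by rewrite l2 Ea Ec; congr (_, _, _); ring: l3.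
  - case: np; exists 1, l; split; first by case=> /eqP; rewrite oner_eq0.
    by rewrite scale1r scale_qform l2 Ea Ec; congr qform; ring: l3.
have Eb : b ^+ 2 * (1 - (l ^+ 3) ^+ 2) = 12 * l ^+ 2 * d * f.
  apply: (mulIf b0); apply/eqP; rewrite -subr_eq0; apply/eqP.
  by rewrite -E3 l2 Ea Ec; ring.
(* If [d f = 0] then again [l^6 = 1]; with [d] or [f] zero, each sign of [l^3] leads to one of the
   two excluded situations. *)
have df0 : d * f != 0.
  apply/eqP => df0.
  have : b ^+ 2 * (1 - (l ^+ 3) ^+ 2) = 0 by rewrite Eb -mulrA df0 mulr0.
  move/eqP; rewrite mulf_eq0 expf_eq0 /= (negbTE b0) /= subr_eq0 eq_sym sqrf_eq1.
  move/eqP: df0; rewrite mulf_eq0.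
  case/orP=> /eqP z0; case/orP=> /eqP l3.
  - case: np; exists 1, (- l); split; first by case=> /eqP; rewrite oner_eq0.
    by rewrite scale1r scale_qform l2 Ea Ec z0; congr qform; ring: l3.
  - case: (nw (l ^+ 2)); first by rewrite exprAC l3 sqrrN expr1n.
    by rewrite l2 Ea Ec z0; congr (_, _, _); ring: l3.
  - case: (nw (l ^+ 2)); first by rewrite exprAC l3 expr1n.
    by rewrite l2 Ea Ec z0; congr (_, _, _); ring: l3.
  - case: np; exists 1, l; split; first by case=> /eqP; rewrite oner_eq0.
    by rewrite scale1r scale_qform l2 Ea Ec z0; congr qform; ring: l3.
exists l; split; split=> //.
- apply: contra_neq df0 => l6; move/eqP: Eb.
  rewrite l6 subrr mulr0 eq_sym -mulrA mulf_eq0 mulf_eq0 pnatr_eq0 expf_eq0 /=.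
  by rewrite (negbTE l0) => /eqP.
- by apply: contra_neq df0 => ->; rewrite mul0r.
- by apply: contra_neq df0 => ->; rewrite mulr0.
Qed.

(* Writing [x = l^3], the even representation of [p] consists of
   [k X^2 + p Y^2] and [m X^2 + n Y^2] below; they were found by factoring the
   Hessian of [p], viewed as a binary cubic in [X^2] and [Y^2]. *)
Lemma even_representation_flip a b c d e f s t u v l :
  [/\ l != 0, (l ^+ 3) ^+ 2 != 1, d != 0 & f != 0] ->
  [/\ a = l * d, c = - (l * f), e = - (l ^+ 2 * b) &
      b ^+ 2 * (1 - (l ^+ 3) ^+ 2) = 12 * l ^+ 2 * d * f] ->
  qform a b c ^+ 3 + qform d e f ^+ 3
  = qform s 0 t ^+ 3 + qform u 0 v ^+ 3 ->
  exists T z w, [/\ z ^+ 3 = 1, w ^+ 3 = 1 &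
    qform a b c - z *: qform u 0 v = T *: (w *: qform s 0 t - qform d e f) \/
    qform a b c - z *: qform s 0 t = T *: (w *: qform u 0 v - qform d e f)].
Proof.
move=> [l0 l6 d0 f0] [-> -> -> Eb] /sum_cubes_coefsP E.
have /= E0 := congr1 (nth 0 ^~ 0%N) E; have /= E2 := congr1 (nth 0 ^~ 2%N) E.
have /= E4 := congr1 (nth 0 ^~ 4%N) E; have /= E6 := congr1 (nth 0 ^~ 6%N) E.
set x := l ^+ 3 in l6 Eb.
have xm : x - 1 != 0 by apply: contra_neq l6 => /eqP; rewrite subr_eq0 => /eqP ->; rewrite expr1n.
have xp : x + 1 != 0 by apply: contra_neq l6 => /eqP; rewrite addr_eq0 => /eqP ->; rewrite sqrrN expr1n.
have x0 : x != 0 by rewrite expf_neq0.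
pose k := - ((2 * x + 1) / (x - 1) * d); pose p := - ((2 * x - 1) / (x + 1) * f).
pose m := (x + 2) / (x - 1) * (l * d); pose n := - ((x - 2) / (x + 1) * (l * f)).
(* The even coefficients involve [b] only through [b^2], so this turns them into rational
   expressions in [l], [d], [f]. *)
have b2 : b ^+ 2 = - 12 * l ^+ 2 * d * f / ((x - 1) * (x + 1)).
  apply: (canRL (mulfK _)); first exact: mulf_neq0.
  by rewrite -[_ * d * f]mulrA; transitivity (- (b ^+ 2 * (1 - x ^+ 2))); [ring | rewrite Eb; ring].
(* The two explicit forms are independent, as uniqueness requires. *)
have det : k * n - m * p != 0.
  have -> : k * n - m * p = 4 * (l * d * f) by rewrite /k /n /m /p; field; rewrite xm xp.
  by rewrite !mulf_neq0 ?pnatr_eq0.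
have n3 : 3 != 0 :> C by rewrite pnatr_eq0.
have F0 : s ^+ 3 + u ^+ 3 = k ^+ 3 + m ^+ 3.
  by rewrite -E0 /k /m /x; field; rewrite -/x xm.
have F1 : s ^+ 2 * t + u ^+ 2 * v = k ^+ 2 * p + m ^+ 2 * n.
  transitivity (s ^+ 2 * t + s * 0 ^+ 2 + (u ^+ 2 * v + u * 0 ^+ 2)); first by ring.
  rewrite -(mulfI n3 E2); transitivity
    (- l ^+ 3 * d ^+ 2 * f + d ^+ 2 * f + (l + l ^+ 4) * d * b ^+ 2); first by ring.
  by rewrite b2 /k /m /p /n /x; field; rewrite -/x xm xp.
have F2 : s * t ^+ 2 + u * v ^+ 2 = k * p ^+ 2 + m * n ^+ 2.
  transitivity (s * t ^+ 2 + 0 ^+ 2 * t + (u * v ^+ 2 + 0 ^+ 2 * v)); first by ring.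
  rewrite -(mulfI n3 E4); transitivity
    (l ^+ 3 * d * f ^+ 2 + d * f ^+ 2 + (l ^+ 4 - l) * f * b ^+ 2); first by ring.
  by rewrite b2 /k /m /p /n /x; field; rewrite -/x xm xp.
have F3 : t ^+ 3 + v ^+ 3 = p ^+ 3 + n ^+ 3.
  by rewrite -E6 /p /n /x; field; rewrite -/x xp.
(* The type relation is checked on the explicit forms; uniqueness then carries it to the given ones,
   and the two possible orders yield the two alternatives. *)
have ET : qform (l * d) b (- (l * f)) - qform m 0 n
          = (l ^- 2) *: (qform k 0 p - qform d (- (l ^+ 2 * b)) f).
  rewrite !sub_qform scale_qform /k /m /p /n /x.
  by congr qform; field; rewrite ?l0 -?/x ?xm ?xp.
have [z [w [z1 w1 [] [Ek Ep Em En]]]] :=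
  sum_cubes_linear_forms_unique _ _ _ _ _ _ _ _ _ det F0 F1 F2 F3.
- exists (l ^- 2), w, z; split=> //; left.
  by rewrite !scale_qform !mulr0 -Ek -Ep -Em -En.
- exists (l ^- 2), w, z; split=> //; right.
  by rewrite !scale_qform !mulr0 -Ek -Ep -Em -En.
Qed.

End Classification.

(** * The primitive cube root of unity *)

Lemma cos_pi_third (R : realType) : trigo.cos (@trigo.pi R / 3) = 1 / 2.
Proof.
set y := @trigo.pi R / 3; set q := trigo.cos y.
have pi0 := trigo.pi_gt0 R.
have q0 : 0 < q by apply: trigo.cos_gt0_pihalf; rewrite /y; apply/andP; split; lra.
(* As [2 y = pi - y], the double angle formula gives [2 q^2 - 1 = - q], whose only positive root is
   [1/2]. *)
have Ey : trigo.cos (y + y) = - q.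
  have -> : y + y = - y + trigo.pi by rewrite /y; lra.
  by rewrite trigo.cosDpi trigo.cosN.
have sq := trigo.cos2Dsin2 y; move: Ey; rewrite trigo.cosD -/q => Ey.
have : (2 * q - 1) * (q + 1) = 0 by rewrite -/q in sq; nra.
by move/eqP; rewrite mulf_eq0 => /orP[] /eqP ?; lra.
Qed.

Lemma omega_root (R : realType) : omega R ^+ 2 + omega R + 1 = 0.
Proof.
pose y := @trigo.pi R / 3.
have E : 2 * @trigo.pi R / 3 = y + y by rewrite /y; lra.
have Ec : trigo.cos (y + y) = - (1 / 2).
  have -> : y + y = - y + trigo.pi by rewrite /y; lra.
  by rewrite trigo.cosDpi trigo.cosN cos_pi_third.
have sq := trigo.cos2Dsin2 (y + y).
rewrite /omega E Ec in sq *.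
by apply/eqP; rewrite eq_complex /=; apply/andP; split; apply/eqP; nra.
Qed.

(** * The reflected representation and the conclusion *)

Section ThirdRepresentation.
Variables (C : numClosedFieldType) (w : C).
Hypothesis w_root : w ^+ 2 + w + 1 = 0.

Lemma qform_cube_eq (a b c d e f : C) :
  qform d e f ^+ 3 = qform a b c ^+ 3 ->
  exists2 k : nat, (k < 3)%N &
    (d, e, f) = (w ^+ k * a, w ^+ k * b, w ^+ k * c).
Proof.
have w0 : w%:MP ^+ 2 + w%:MP + 1 = 0 :> {mpoly C[2]}.
  by rewrite -rmorphXn -rmorphD -(rmorph1 (@mpolyC 2 _)) -rmorphD w_root rmorph0.
move=> /(cube_eq_roots _ _ _ _ w0)[k k3]; rewrite -rmorphXn mul_mpolyC scale_qform.
by move=> /qform_inj[-> -> ->]; exists k.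
Qed.

(** If [b] were nonzero, some power of [w] would be [-1], but powers of [w] have cube 1. *)
Lemma reflected_cube_eq (a b c : C) :
  qform a (- b) c ^+ 3 = qform a b c ^+ 3 -> b = 0.
Proof.
move=> /qform_cube_eq [k _ [_ Eb _]]; apply/eqP; apply: contraT => b0.
have wk : w ^+ k = -1 by apply: (mulIf b0); rewrite -Eb mulN1r.
have w3 : w ^+ 3 = 1.
  apply/eqP; rewrite -subr_eq0; apply/eqP.
  transitivity ((w - 1) * (w ^+ 2 + w + 1)); first by ring.
  by rewrite w_root mulr0.
have : (w ^+ k) ^+ 3 = 1 by rewrite exprAC w3 expr1n.
rewrite wk exprS sqrrN expr1n mulr1 => /eqP.
by rewrite eqNr oner_eq0.
Qed.

(** Matching in order forces [b = e = 0]; matching crosswise is the excluded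
    [f2 = w^k (a, -b, c)]. *)
Lemma reflected_cubes_neq (a b c d e f : C) :
  (b, e) <> (0, 0) ->
  (forall k : nat, (k < 3)%N ->
     (d, e, f) <> (w ^+ k * a, w ^+ k * - b, w ^+ k * c)) ->
  ~ same_pair (qform a (- b) c ^+ 3) (qform d (- e) f ^+ 3)
              (qform a b c ^+ 3) (qform d e f ^+ 3).
Proof.
move=> be nw [[E1 E2] | [E1 _]].
- by apply: be; rewrite (reflected_cube_eq _ _ _ E1) (reflected_cube_eq _ _ _ E2).
- by have [k /nw] := qform_cube_eq _ _ _ _ _ _ (esym E1).
Qed.

(** The equality of cubes forces [b = 0], so the reflection changes nothing. *)
Lemma reflected_cube_even (a b c s t : C) :
  qform a (- b) c ^+ 3 = qform s 0 t ^+ 3 ->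
  proportional (qform a b c) (qform s 0 t).
Proof.
move=> /qform_cube_eq [k k3 []] -> Eb ->.
have -> : b = 0 by move/eqP: Eb; rewrite mulr0 oppr_eq0 => /eqP.
exists 1, (w ^+ k); split; first by case=> /eqP; rewrite oner_eq0.
by rewrite scale1r scale_qform mulr0.
Qed.

(** The whole argument uses of [omega] only the equation [w^2 + w + 1 = 0], hence this form over a
    closed field. *)
Lemma even_sum_cubes_flip_and_third_representation (a b c d e f : C)
    (f1 f2 f3 f4 p : {mpoly C[2]})
    (def_f1 : f1 = qform a b c) (def_f2 : f2 = qform d e f)
    (def_p : p = f1 ^+ 3 + f2 ^+ 3) (p_even : even_in_y p)
    (f3_even : even_quadratic f3) (f4_even : even_quadratic f4)
    (p_f34 : p = f3 ^+ 3 + f4 ^+ 3)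
    (f_nonprop : pairwise_nonproportional f1 f2 f3 f4)
    (be_neq0 : (b, e) <> (0, 0))
    (f2_neq : forall k : nat, (k < 3)%N ->
       (d, e, f) <> (w ^+ k * a, w ^+ k * - b, w ^+ k * c)) :
  (exists T : C,
     has_type T (flip1 (identity_of_forms f1 f2 f3 f4)) \/
     has_type T (flip2 (identity_of_forms f1 f2 f3 f4))) /\
  (exists g1 g2 : {mpoly C[2]},
     [/\ binary_quadratic g1, binary_quadratic g2,
         p = g1 ^+ 3 + g2 ^+ 3,
         ~ same_pair (g1 ^+ 3) (g2 ^+ 3) (f1 ^+ 3) (f2 ^+ 3) &
         ~ same_pair (g1 ^+ 3) (g2 ^+ 3) (f3 ^+ 3) (f4 ^+ 3)]).
Proof.
have [[np12 np13 np14] [np23 np24 np34]] := f_nonprop.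
have [s [t def_f3]] := f3_even; have [u [v def_f4]] := f4_even.
have quad x y z : binary_quadratic (qform x y z : {mpoly C[2]}) by exists x, y, z.
rewrite {}def_p in p_even p_f34 *; split; last first.
  exists (qform a (- b) c), (qform d (- e) f); split; try exact: quad.
  - by rewrite def_f1 def_f2 in p_even *; exact: reflect_sum_cubes.
  - by rewrite def_f1 def_f2; exact: reflected_cubes_neq.
  - rewrite def_f1 def_f3 def_f4 in np13 np14 * => -[[E _]|[E _]].
      by apply: np13; apply: reflected_cube_even.
    by apply: np14; apply: reflected_cube_even.
have nw z : z ^+ 3 = 1 -> (d, e, f) <> (z * a, z * - b, z * c).
  rewrite -(expr1n _ 3) => /(cube_eq_roots _ _ _ _ w_root) [k k3 ->].
  by rewrite mulr1; exact: f2_neq.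
rewrite {1}def_f1 {1}def_f2 in p_even.
have [E1 E3 E5] := even_sum_cubes _ _ _ _ _ _ _ p_even.
rewrite {1}def_f1 {1}def_f2 in np12.
have [l [Hl Hp]] := even_sum_cubes_param _ _ _ _ _ _ _ E1 E3 E5 be_neq0 np12 nw.
have E : qform a b c ^+ 3 + qform d e f ^+ 3 = qform s 0 t ^+ 3 + qform u 0 v ^+ 3.
  rewrite -def_f1 -def_f2 -def_f3 -def_f4; exact: p_f34.
have [T [z [z' [z1 z1']]]] := even_representation_flip _ _ _ _ _ _ _ _ _ _ _ _ Hl Hp E.
rewrite -def_f1 -def_f2 -def_f3 -def_f4 => ET.
have q1 : binary_quadratic f1 by rewrite def_f1; exact: quad.
have q2 : binary_quadratic f2 by rewrite def_f2; exact: quad.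
have q3 : binary_quadratic f3 by rewrite def_f3; exact: quad.
have q4 : binary_quadratic f4 by rewrite def_f4; exact: quad.
(* The second flip is the first flip of the identity with [f3] and [f4] exchanged. *)
exists T; case: ET => ET; [right | left].
- have p_f43 : f1 ^+ 3 + f2 ^+ 3 = f4 ^+ 3 + f3 ^+ 3.
    by rewrite [RHS]addrC.
  have np43 : pairwise_nonproportional f1 f2 f4 f3.
    have [[np12' _ _] _] := f_nonprop.
    by split; split; [exact: np12' | exact: np14 | exact: np13 | exact: np24
                     | exact: np23 | move/proportional_sym; exact: np34].
  exact: (has_type_flip1 _ T z z' f1 f2 f4 f3 z1 z1' (And4 q1 q2 q4 q3) np43 p_f43 ET).
- exact: (has_type_flip1 _ T z z' f1 f2 f3 f4 z1 z1' (And4 q1 q2 q3 q4) f_nonprop p_f34 ET).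
Qed.

End ThirdRepresentation.

Theorem theorem3p2 (R : realType) (a b c d e f : R[i])
    (f1 f2 f3 f4 p : {mpoly R[i][2]})
    (def_f1 : f1 = qform a b c) (def_f2 : f2 = qform d e f)
    (def_p : p = f1 ^+ 3 + f2 ^+ 3) (p_even : even_in_y p)
    (f3_even : even_quadratic f3) (f4_even : even_quadratic f4)
    (p_f34 : p = f3 ^+ 3 + f4 ^+ 3)
    (f_nonprop : pairwise_nonproportional f1 f2 f3 f4)
    (be_neq0 : (b, e) <> (0, 0))
    (f2_neq : forall k : nat, (k < 3)%N ->
       (d, e, f) <> (omega R ^+ k * a, omega R ^+ k * - b, omega R ^+ k * c)) :
  (exists T : R[i],
     has_type T (flip1 (identity_of_forms f1 f2 f3 f4)) \/
     has_type T (flip2 (identity_of_forms f1 f2 f3 f4))) /\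
  (exists g1 g2 : {mpoly R[i][2]},
     [/\ binary_quadratic g1, binary_quadratic g2,
         p = g1 ^+ 3 + g2 ^+ 3,
         ~ same_pair (g1 ^+ 3) (g2 ^+ 3) (f1 ^+ 3) (f2 ^+ 3) &
         ~ same_pair (g1 ^+ 3) (g2 ^+ 3) (f3 ^+ 3) (f4 ^+ 3)]).
Proof.
exact: (even_sum_cubes_flip_and_third_representation _ _ (omega_root R) a b c d e f f1 f2 f3 f4 p
  def_f1 def_f2 def_p p_even f3_even f4_even p_f34 f_nonprop be_neq0 f2_neq).
Qed.
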